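(* Given a kinematic triangle $\triangle abc$ and events $d,e$ with $[b\;c\;d]$ and $[c\;e\;a]$, if there is a path $de$ (that is, $d\neq e$ and some path, denoted $de$, contains both), then on the path $de$ there is an event $f$ such that $$[a\;f\;b]\quad\text{and}\quad[d\;e\;f].$$
   Context: Let $\mathcal E$ be a set, whose elements are called events; let $\mathcal P$ be a set of subsets of $\mathcal E$, whose elements are called paths; and let $[\,\cdot\;\cdot\;\cdot\,]$ be a ternary relation (betweenness) on $\mathcal E$. A finite chain is a sequence $(q_0,\dots,q_n)$ of events, $n\ge1$, such that: if $n=1$, then $q_0\ne q_1$ and some path contains both; if $n\ge2$, then $[q_i\;q_j\;q_k]$ for all $0\le i<j<k\le n$. The following axioms are assumed. (I1) $\mathcal E\neq\emptyset$. (I2) For distinct events $a,b$ there are paths $R\ni a$, $S\ni b$ with $R\cap S\ne\emptyset$. (I3) For any two distinct events there is at most one path containing both. (O1) If $[a\;b\;c]$ then some path contains $a,b,c$. (O2) $[a\;b\;c]\Rightarrow[c\;b\;a]$. (O3) $[a\;b\;c]\Rightarrow a\neq c$. (O4) $[a\;b\;c]$ and $[b\;c\;d]$ imply $[a\;b\;d]$ (no distinctness of $a,d$ is assumed). (O5) If $a,b,c$ are distinct events of one path, then $[a\;b\;c]$ or $[b\;c\;a]$ or $[c\;a\;b]$. (O6) If $Q,R,S$ are distinct paths, $T$ is a path, $a\in Q\cap R$, $b\in Q\cap S$, $c\in R\cap S$, and there are $d\in S$ with $[b\;c\;d]$ and $e\in R$ with $[c\;e\;a]$ and $d,e\in T$,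 then there is $f\in T\cap Q$ belonging to a finite chain with first event $a$ and last event $b$, where $a,f,b$ are distinct. A kinematic triangle $\triangle abc$ is a set of three distinct events $\{a,b,c\}$ such that each pair of these events belongs to one of three distinct paths. *)

(* Defs.v *)
From mathcomp Require Import all_boot.
From mathcomp Require Import boolp classical_sets.

Set Implicit Arguments.
Unset Strict Implicit.
Unset Printing Implicit Defensive.

Local Open Scope classical_set_scope.

(* Events are the elements of [E], paths the members of [P : set (set E)], and
   [btw a b c] is the betweenness relation [a b c]. *)

Section Kinematic.
Variables (E : Type) (P : set (set E)) (btw : E -> E -> E -> Prop).

(* The sequence (q_0, ..., q_n) is the function [q] on {0, ..., n}. *)
Definition finite_chain (n : nat) (q : 'I_n.+1 -> E) : Prop :=
  [/\ (1 <= n)%N,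
      n = 1%N ->
        q ord0 <> q ord_max /\ (exists2 Q, P Q & Q (q ord0) /\ Q (q ord_max))
    & (2 <= n)%N ->
        forall i j k : 'I_n.+1, (i < j)%N -> (j < k)%N -> btw (q i) (q j) (q k)].

Definition on_chain_from_to (a b f : E) : Prop :=
  exists (n : nat) (q : 'I_n.+1 -> E),
    [/\ finite_chain q, q ord0 = a, q ord_max = b & exists i, q i = f].

Record kinematic_axioms : Prop := KinematicAxioms {
  axI1 : [set: E] !=set0;
  axI2 : forall a b, a <> b ->
    exists R S, [/\ P R, P S, R a, S b & R `&` S !=set0];
  axI3 : forall a b, a <> b ->
    forall R S, P R -> P S -> R a -> R b -> S a -> S b -> R = S;
  axO1 : forall a b c, btw a b c -> exists2 Q, P Q & [/\ Q a, Q b & Q c];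
  axO2 : forall a b c, btw a b c -> btw c b a;
  axO3 : forall a b c, btw a b c -> a <> c;
  axO4 : forall a b c d, btw a b c -> btw b c d -> btw a b d;
  axO5 : forall Q a b c, P Q -> Q a -> Q b -> Q c ->
    a <> b -> a <> c -> b <> c ->
    [\/ btw a b c, btw b c a | btw c a b];
  axO6 : forall Q R S T a b c,
    P Q -> P R -> P S -> Q <> R -> Q <> S -> R <> S -> P T ->
    (Q `&` R) a -> (Q `&` S) b -> (R `&` S) c ->
    (exists d e, [/\ S d, btw b c d, R e, btw c e a & T d /\ T e]) ->
    exists f, [/\ (T `&` Q) f, on_chain_from_to a b f
                & [/\ a <> f, a <> b & f <> b]]
}.

Definition kinematic_triangle (a b c : E) : Prop :=
  [/\ a <> b, a <> c, b <> c
    & exists Q R S,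
        [/\ [/\ P Q, P R & P S],
            [/\ Q <> R, Q <> S & R <> S],
            Q a /\ Q b, R a /\ R c & S b /\ S c]].

End Kinematic.

(* Main.v *)
Require Import Defs.
From mathcomp Require Import all_boot.
From mathcomp Require Import boolp classical_sets.

(** Axiom (O6), applied to the triangle [abc], yields the event [f] of [de]
    between [a] and [b]; the events [d], [e], [f] are distinct, so by (O5) it
    remains to exclude [[e f d]] and [[f d e]].  If [[e f d]], then (O6) applied
    to the triangle [ced] and the path [ab] shows that [ab] meets [cd] between
    [c] and [d], that is, [[d b c]], against [[b c d]].  If [[f d e]], then (O6)
    applied to the triangle [afe] and the path [bc] shows that [bc] meets [ae]
    between [a] and [e], that is, [[e c a]], against [[c e a]]. *)

Section Betweenness.
Set Implicit Arguments.
Unset Strict Implicit.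

Variables (E : Type) (P : set (set E)) (btw : E -> E -> E -> Prop).
Hypothesis ax : kinematic_axioms P btw.

(** If [a = b], then [[c a a]] and [[a a c]] give [[c a c]] by (O4), against (O3). *)
Lemma btw_neq12 a b c : btw a b c -> a <> b.
Proof.
move=> abc ab; subst b.
exact: (axO3 ax (axO4 ax (axO2 ax abc) abc)).
Qed.

Lemma btw_neq23 a b c : btw a b c -> b <> c.
Proof. by move=> /(axO2 ax)/btw_neq12 cb /esym. Qed.

(** (O4) with equal outer events would give [[a b a]], against (O3). *)
Lemma btw_rotF a b c : btw a b c -> ~ btw b c a.
Proof. by move=> abc bca; apply: (axO3 ax (axO4 ax abc bca)). Qed.

Lemma btw_on_path2 a b c Q : btw a b c -> P Q -> Q a -> Q c -> Q b.
Proof.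
move=> abc PQ Qa Qc; have [Q' PQ' [Q'a Q'b Q'c]] := axO1 ax abc.
by rewrite (axI3 ax (axO3 ax abc) PQ PQ' Qa Qc Q'a Q'c).
Qed.

Lemma btw_on_path3 a b c Q : btw a b c -> P Q -> Q a -> Q b -> Q c.
Proof.
move=> abc PQ Qa Qb; have [Q' PQ' [Q'a Q'b Q'c]] := axO1 ax abc.
by rewrite (axI3 ax (btw_neq12 abc) PQ PQ' Qa Qb Q'a Q'b).
Qed.

Lemma path_meet_unique Q R x y :
  P Q -> P R -> Q <> R -> Q x -> R x -> Q y -> R y -> x = y.
Proof.
move=> PQ PR QR Qx Rx Qy Ry; case: (pselect (x = y)) => // xy.
by case: QR; apply: (axI3 ax xy).
Qed.

(** As [f] is neither end, its index [i] satisfies [0 < i < n]; so [n >= 2], and the betweenness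
    clause applies to [0], [i], [n]. *)
Lemma on_chain_btw a b f :
  on_chain_from_to P btw a b f -> a <> f -> f <> b -> btw a f b.
Proof.
move=> [n [q [[_ _ q_btw] <- <- [i <-]]]] q0i qin.
have i_gt0 : (0 < i)%N.
  by rewrite lt0n; apply/eqP => i0; apply: q0i; congr q; apply: val_inj.
have i_ltn : (i < n)%N.
  rewrite ltn_neqAle -ltnS ltn_ord andbT; apply/eqP => i_n.
  by apply: qin; congr q; apply: val_inj.
by apply: q_btw => //; apply: leq_ltn_trans i_ltn.
Qed.

(** (O6) with its chain sharpened to a betweenness, the form used for all three triangles. *)
Lemma veblen Q R S T a b c d e :
    P Q -> P R -> P S -> P T -> Q <> R -> Q <> S -> R <> S ->
    Q a -> R a -> Q b -> S b -> R c -> S c ->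
    btw b c d -> btw c e a -> T d -> T e ->
  exists f, [/\ T f, Q f & btw a f b].
Proof.
move=> PQ PR PS PT QR QS RS Qa Ra Qb Sb Rc Sc bcd cea Td Te.
have Sd : S d by apply: btw_on_path3 bcd _ _ _.
have Re : R e by apply: btw_on_path2 cea _ _ _.
have [||||f [[Tf Qf] chain_f [af _ fb]]] :=
  @axO6 _ _ _ ax Q R S T a b c PQ PR PS QR QS RS PT => //.
  by exists d, e.
by exists f; split => //; apply: on_chain_btw.
Qed.

End Betweenness.

Theorem theorem7 (E : Type) (P : set (set E)) (btw : E -> E -> E -> Prop)
    (axioms : kinematic_axioms P btw)
    (a b c d e : E) (habc : kinematic_triangle P a b c)
    (hbcd : btw b c d) (hcea : btw c e a)
    (hde : d <> e) (de : set E) (hP : P de) (hd : de d) (he : de e) :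
  exists f : E, [/\ de f, btw a f b & btw d e f].
Proof.
case: habc => _ _ _ [Q [R [S [[PQ PR PS] [QR QS RS] [Qa Qb] [Ra Rc] [Sb Sc]]]]].
have Sd : S d by apply: (btw_on_path3 axioms hbcd).
have Re : R e by apply: (btw_on_path2 axioms hcea).
have QRmeet x : Q x -> R x -> x = a.
  by move=> Qx Rx; apply: (path_meet_unique axioms PQ PR).
have QSmeet x : Q x -> S x -> x = b.
  by move=> Qx Sx; apply: (path_meet_unique axioms PQ PS).
have RSmeet x : R x -> S x -> x = c.
  by move=> Rx Sx; apply: (path_meet_unique axioms PR PS).
have nQd : ~ Q d by move=> /QSmeet/(_ Sd)/esym; exact: (axO3 axioms hbcd).
have nQe : ~ Q e by move=> /QRmeet/(_ Re); exact: (btw_neq23 axioms hcea).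
have nRd : ~ R d by move=> /RSmeet/(_ Sd)/esym; exact: (btw_neq23 axioms hbcd).
have nSe : ~ S e by move=> /(RSmeet _ Re)/esym; exact: (btw_neq12 axioms hcea).
(* Being distinct from the three sides, [de] can itself be a side of the two later triangles. *)
have nQT : Q <> de by move=> QT; apply: nQd; rewrite QT.
have nRT : R <> de by move=> RT; apply: nRd; rewrite RT.
have nST : S <> de by move=> ST; apply: nSe; rewrite ST.
have [f [Tf Qf afb]] := veblen axioms
  PQ PR PS hP QR QS RS Qa Ra Qb Sb Rc Sc hbcd hcea hd he.
exists f; split => //.
have df : d <> f by move=> df; apply: nQd; rewrite df.
have ef : e <> f by move=> ef; apply: nQe; rewrite ef.
have [//|efd|fde] := axO5 axioms hP hd he Tf hde df ef.
(* The transversal [Q] passes through [a] on [ce] produced and [f] on [ed]; it meets [S] only in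
   [b]. *)
- have [x [Qx Sx dxc]] := veblen axioms
    PS hP PR PQ nST (nesym RS) (nesym nRT) Sd hd Sc Rc he Re hcea efd Qa Qf.
  rewrite (QSmeet x Qx Sx) in dxc.
  by case: (btw_rotF axioms dxc hbcd).
(* The transversal [S] passes through [b] on [af] produced and [d] on [fe]; it meets [R] only in
   [c]. *)
- have [x [Sx Rx exa]] := veblen axioms
    PR hP PQ PS nRT (nesym QR) (nesym nQT) Re he Ra Qa Tf Qf afb fde Sb Sd.
  rewrite (RSmeet x Rx Sx) in exa.
  by case: (btw_rotF axioms (axO2 axioms exa) hcea).
Qed.
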